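(* Let $X$ be a connected and locally path connected space. Then the following statements are equivalent: (i) $X$ is semi-locally small generated. (ii) For each $x\in X$, every nonempty subset $U$ of $\pi_1^{qtop}(X,x)$ is open if and only if $U$ is a union of some cosets of $\pi_1^{sg}(X,x)$.
   Context: All homotopies of paths are relative to end points. $\pi_1^{qtop}(X,x)$ is the group $\pi_1(X,x)$ with the quotient topology induced by the canonical map $q:\Omega(X,x)\to\pi_1(X,x)$, $q(\alpha)=[\alpha]$, where $\Omega(X,x)$ is the space of loops in $X$ based at $x$ with the compact-open topology. For $y\in X$, the small loop group $\pi_1^s(X,y)\le \pi_1(X,y)$ is the subgroup of all classes $[\beta]$ of loops $\beta$ at $y$ such that for every open neighborhood $V$ of $y$, $\beta$ is homotopic to a loop at $y$ lying in $V$. The SG (small generated) subgroup $\pi_1^{sg}(X,x)$ is the (normal) subgroup of $\pi_1(X,x)$ generated by all elements $[\alpha*\beta*\alpha^{-1}]$, where $\alpha$ is a path in $X$ with $\alpha(0)=x$ and $[\beta]\in\pi_1^s(X,\alpha(1))$. A space $X$ is semi-locally small generated if for each $x\in X$ there is an open neighborhood $U$ of $x$ such that $i_*\pi_1(U,x)\le \pi_1^{sg}(X,x)$, where $i:U\hookrightarrow X$ is the inclusion. *)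

(* Defs.v *)
From HB Require Import structures.
From mathcomp Require Import all_boot all_order all_algebra generic_quotient.
From mathcomp Require Import all_classical reals topology normedtype homotopy.
From mathcomp Require Import lra.

Set Implicit Arguments.
Unset Strict Implicit.
Unset Printing Implicit Defensive.

Import Order.TTheory GRing.Theory Num.Theory numFieldNormedType.Exports.
Local Open Scope classical_set_scope.
Local Open Scope ring_scope.
Local Open Scope quotient_scope.

Section unit_interval.
Context {R : realType}.

(* A bipointed space, so that [{path unit_interval R from x to y in X}] is the
   space of paths of the library, with the compact-open topology. *)
Definition unit_interval : Type := set_type (`[0, 1]%classic : set R).

HB.instance Definition _ := 
  Topological.copy unit_interval (set_type (`[0, 1]%classic : set R)).

Lemma clamp_subproof (r : R) :
  Num.max 0 (Num.min 1 r) \in (`[0, 1]%classic : set R).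
Proof.
rewrite inE /= in_itv /= le_max lexx /= ge_max ler01 /=.
by rewrite ge_min lexx.
Qed.

(* The retraction of R onto [0, 1]. *)
Definition clamp (r : R) : unit_interval := SigSub (clamp_subproof r).

Definition ival (t : unit_interval) : R := set_val t.

Lemma ival_ge0 t : 0 <= ival t.
Proof. by have := set_mem (valP t); rewrite /= in_itv /= => /andP[]. Qed.

Lemma ival_le1 t : ival t <= 1.
Proof. by have := set_mem (valP t); rewrite /= in_itv /= => /andP[]. Qed.

Lemma ival_inj : injective ival.
Proof. exact: val_inj. Qed.

Lemma ival_clamp r : ival (clamp r) = Num.max 0 (Num.min 1 r).
Proof. by []. Qed.

Lemma clampK r : 0 <= r -> r <= 1 -> ival (clamp r) = r.
Proof. by move=> r0 r1; rewrite ival_clamp (min_idPr r1) (max_idPr r0). Qed.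

Lemma ivalK t : clamp (ival t) = t.
Proof. by apply: ival_inj; rewrite clampK ?ival_ge0 ?ival_le1. Qed.

Lemma zero_neq_one_unit_interval : clamp 0 != clamp 1.
Proof.
apply/negP => /eqP /(congr1 ival); rewrite !clampK ?lexx ?ler01 //.
by move/eqP; rewrite eq_sym oner_eq0.
Qed.

HB.instance Definition _ :=
  isBiPointed.Build unit_interval zero_neq_one_unit_interval.

Lemma ival0 : ival zero = 0.
Proof. by rewrite clampK ?ler01. Qed.

Lemma ival1 : ival one = 1.
Proof. by rewrite clampK ?ler01. Qed.

Lemma clamp_le0 r : r <= 0 -> clamp r = zero.
Proof.
move=> r0; apply: ival_inj; rewrite ival0 ival_clamp.
by rewrite (min_idPr _) ?(max_idPl r0)// (le_trans r0).
Qed.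

Lemma clamp_ge1 r : 1 <= r -> clamp r = one.
Proof.
by move=> r1; apply: ival_inj; rewrite ival1 ival_clamp (min_idPl r1) (max_idPr ler01).
Qed.

Lemma ival_continuous : continuous ival.
Proof. exact: initial_continuous. Qed.

Lemma clamp_continuous : continuous clamp.
Proof.
apply: continuous_comp_initial => r.
apply: (@continuous_max R R (cst 0) (cst 1 \min id)); first exact: cst_continuous.
by apply: continuous_min; [exact: cst_continuous|exact: cvg_id].
Qed.

End unit_interval.
Arguments unit_interval : clear implicits.

Lemma fst_continuous (X Y : topologicalType) : continuous (@fst X Y).
Proof. by move=> xy; exact: cvg_fst. Qed.

Lemma snd_continuous (X Y : topologicalType) : continuous (@snd X Y).
Proof. by move=> xy; exact: cvg_snd. Qed.

Section continuity.
Context {R : realType} {Z X : topologicalType}.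
Local Notation I := (unit_interval R).

Lemma continuous_if_le (u : Z -> R) (c : R) (f g : Z -> X) :
  continuous u -> continuous f -> continuous g ->
  (forall z, u z = c -> f z = g z) ->
  continuous (fun z => if u z <= c then f z else g z).
Proof.
move=> cu cf cg fg; set h := fun z => _.
have cA : closed (u @^-1` [set r | r <= c]).
  by apply: closed_comp => [z _|]; [exact: cu|exact: closed_le].
have cB : closed (u @^-1` [set r | c <= r]).
  by apply: closed_comp => [z _|]; [exact: cu|exact: closed_ge].
apply/continuous_subspace_setT.
have -> : [set: Z] = u @^-1` [set r | r <= c] `|` u @^-1` [set r | c <= r].
  by apply/seteqP; split=> // z _ /=; apply/orP/le_total.
apply: withinU_continuous => //.
- apply: (@subspace_eq_continuous _ _ _ f); last exact: continuous_subspaceT.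
  by move=> z; rewrite inE /= /from_subspace /h => ->.
- apply: (@subspace_eq_continuous _ _ _ g); last exact: continuous_subspaceT.
  move=> z; rewrite inE /= /from_subspace /h => uz.
  by case: ifPn => // zu; rewrite fg//; apply/eqP; rewrite eq_le zu uz.
Qed.

Lemma continuous_clamp (u : Z -> R) :
  continuous u -> continuous (fun z => clamp (u z)).
Proof. by move=> cu z; apply: continuous_comp; [exact: cu|exact: clamp_continuous]. Qed.

Lemma continuous_ival (f : Z -> I) :
  continuous f -> continuous (fun z => ival (f z)).
Proof. by move=> cf z; apply: continuous_comp; [exact: cf|exact: ival_continuous]. Qed.

Lemma continuous_affine (a b : R) (u : Z -> R) :
  continuous u -> continuous (fun z => a * u z + b).
Proof.
move=> cu z; apply: (@cvgD _ R^o); last exact: cvg_cst.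
by apply: (@cvgM R); [exact: cvg_cst|exact: cu].
Qed.

Lemma continuous_minr (u v : Z -> R) : continuous u -> continuous v ->
  continuous (fun z => Num.min (u z) (v z)).
Proof. by move=> cu cv z; apply: (@continuous_min R Z u v); [exact: cu|exact: cv]. Qed.

Lemma continuous_dil (a b : R) (f : Z -> I) :
  continuous f -> continuous (fun z => clamp (a * ival (f z) + b)).
Proof. by move=> cf; apply/continuous_clamp/continuous_affine/continuous_ival. Qed.

Lemma continuous_dil0 (a : R) (f : Z -> I) :
  continuous f -> continuous (fun z => clamp (a * ival (f z))).
Proof.
move=> cf; under eq_fun do rewrite -[_ * _]addr0; exact: continuous_dil.
Qed.

Lemma continuous_id_fun : continuous (fun z : Z => z).
Proof. by move=> z; exact: cvg_id. Qed.

Lemma continuous_compose (Y : topologicalType) (f : Z -> Y) (g : Y -> X) :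
  continuous f -> continuous g -> continuous (fun z => g (f z)).
Proof. by move=> cf cg z; apply: continuous_comp; [exact: cf|exact: cg]. Qed.

Lemma continuous_pair (Y : topologicalType) (f : Z -> Y) (g : Z -> X) :
  continuous f -> continuous g -> continuous (fun z => (f z, g z)).
Proof. by move=> cf cg z; apply: (cvg_pair (cf z) (cg z)). Qed.

End continuity.

Section paths.
Context {R : realType} {X : topologicalType}.
Local Notation I := (unit_interval R).
Implicit Types x y z : X.

Definition concat_fun (f g : I -> X) (t : I) : X :=
  if ival t <= 2^-1 then f (clamp (2 * ival t))
  else g (clamp (2 * ival t - 1)).

Lemma concat_continuous (f g : I -> X) : continuous f -> continuous g ->
  f one = g zero -> continuous (concat_fun f g).
Proof.
move=> cf cg fg; apply: continuous_if_le.
- exact: ival_continuous.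
- apply: continuous_compose cf; exact/continuous_dil0/continuous_id_fun.
- apply: continuous_compose cg; exact/continuous_dil/continuous_id_fun.
- by move=> t ->; rewrite divff ?pnatr_eq0// subrr clamp_ge1// clamp_le0.
Qed.

Section concat.
Variables (x y z : X) (p : {path I from x to y in X}) (q : {path I from y to z in X}).

Lemma concat_cts : continuous (concat_fun p q).
Proof.
by apply: concat_continuous; [exact: cts_fun..|rewrite path_one path_zero].
Qed.

Lemma concat_zero : concat_fun p q zero = x.
Proof. by rewrite /concat_fun ival0 invr_ge0 ler0n mulr0 clamp_le0// path_zero. Qed.

Lemma concat_one : concat_fun p q one = z.
Proof.
rewrite /concat_fun ival1 lt_geF ?invf_lt1 ?ltr1n// mulr1 clamp_ge1 ?path_one//.
by rewrite lerBrDr.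
Qed.

Definition path_concat : {path I from x to z in X} :=
  mk_path concat_cts concat_zero concat_one.
End concat.

Section reverse.
Variables (x y : X) (p : {path I from x to y in X}).

Definition reverse_fun (t : I) : X := p (clamp (1 - ival t)).

Lemma reverse_arg_continuous : continuous (fun t : I => clamp (1 - ival t)).
Proof.
under eq_fun do rewrite addrC -mulN1r; exact: (@continuous_dil R I (- 1) 1 id (@continuous_id_fun I)).
Qed.

Lemma reverse_cts : continuous reverse_fun.
Proof.
apply: continuous_compose; first exact: reverse_arg_continuous.
exact: cts_fun.
Qed.

Lemma reverse_zero : reverse_fun zero = y.
Proof. by rewrite /reverse_fun ival0 subr0 clamp_ge1// path_one. Qed.

Lemma reverse_one : reverse_fun one = x.
Proof. by rewrite /reverse_fun ival1 subrr clamp_le0// path_zero. Qed.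

Definition path_reverse : {path I from y to x in X} :=
  mk_path reverse_cts reverse_zero reverse_one.
End reverse.

Definition path_cst x : {path I from x to x in X} := cst x.

Definition homotopic x y (p q : {path I from x to y in X}) : Prop :=
  exists H : I * I -> X, [/\ continuous H,
    forall s, H (s, zero) = p s, forall s, H (s, one) = q s,
    forall t, H (zero, t) = x & forall t, H (one, t) = y].

Lemma homotopic_refl x y (p : {path I from x to y in X}) : homotopic p p.
Proof.
exists (p \o fst); split=> [|//|//|_|_] /=; last 2 first.
- exact: path_zero.
- exact: path_one.
by apply: continuous_compose; [exact: fst_continuous|exact: cts_fun].
Qed.

Lemma homotopic_sym x y (p q : {path I from x to y in X}) :
  homotopic p q -> homotopic q p.
Proof.
move=> [H [cH H0 H1 Hx Hy]].
exists (fun st => H (st.1, clamp (1 - ival st.2))); split => /=.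
- apply: continuous_compose cH.
  apply: continuous_pair; first exact: fst_continuous.
  apply: continuous_compose reverse_arg_continuous.
  exact: snd_continuous.
- by move=> s; rewrite ival0 subr0 clamp_ge1.
- by move=> s; rewrite ival1 subrr clamp_le0.
- by move=> t; rewrite Hx.
- by move=> t; rewrite Hy.
Qed.

Lemma homotopic_trans x y (q p r : {path I from x to y in X}) :
  homotopic p q -> homotopic q r -> homotopic p r.
Proof.
move=> [H [cH H0 H1 Hx Hy]] [K [cK K0 K1 Kx Ky]].
exists (fun st => if ival st.2 <= 2^-1 then H (st.1, clamp (2 * ival st.2))
                  else K (st.1, clamp (2 * ival st.2 - 1))); split => /=.
- have csnd : continuous (snd : I * I -> I) by exact: snd_continuous.
  apply: continuous_if_le.
  + exact: continuous_ival.
  + apply: continuous_compose cH.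
    apply: continuous_pair; first exact: fst_continuous.
    exact: continuous_dil0.
  + apply: continuous_compose cK.
    apply: continuous_pair; first exact: fst_continuous.
    exact: continuous_dil.
  + move=> st ->; rewrite divff ?pnatr_eq0// subrr clamp_ge1// clamp_le0//.
    by rewrite H1 K0.
- by move=> s; rewrite ival0 invr_ge0 ler0n mulr0 clamp_le0.
- move=> s; rewrite ival1 lt_geF ?invf_lt1 ?ltr1n// mulr1 clamp_ge1//.
  by rewrite lerBrDr.
- by move=> t; rewrite Hx Kx if_same.
- by move=> t; rewrite Hy Ky if_same.
Qed.

Lemma homotopic_concat x y z (p p' : {path I from x to y in X})
    (q q' : {path I from y to z in X}) :
  homotopic p p' -> homotopic q q' ->
  homotopic (path_concat p q) (path_concat p' q').
Proof.
move=> [H [cH H0 H1 Hx Hy]] [K [cK K0 K1 Kx Ky]].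
exists (fun st => if ival st.1 <= 2^-1 then H (clamp (2 * ival st.1), st.2)
                  else K (clamp (2 * ival st.1 - 1), st.2)); split => /=.
- have cfst : continuous (fst : I * I -> I) by exact: fst_continuous.
  apply: continuous_if_le.
  + exact: continuous_ival.
  + apply: continuous_compose cH.
    apply: continuous_pair; last exact: snd_continuous.
    exact: continuous_dil0.
  + apply: continuous_compose cK.
    apply: continuous_pair; last exact: snd_continuous.
    exact: continuous_dil.
  + move=> st ->; rewrite divff ?pnatr_eq0// subrr clamp_ge1// clamp_le0//.
    by rewrite Hy Kx.
- by move=> s; rewrite H0 K0.
- by move=> s; rewrite H1 K1.
- by move=> t; rewrite ival0 invr_ge0 ler0n mulr0 clamp_le0.
- move=> t; rewrite ival1 lt_geF ?invf_lt1 ?ltr1n// mulr1 clamp_ge1 ?Ky//.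
  by rewrite lerBrDr.
Qed.

Lemma homotopic_reverse x y (p q : {path I from x to y in X}) :
  homotopic p q -> homotopic (path_reverse p) (path_reverse q).
Proof.
move=> [H [cH H0 H1 Hx Hy]].
exists (fun st => H (clamp (1 - ival st.1), st.2)); split => /=.
- apply: continuous_compose cH.
  apply: continuous_pair; last exact: snd_continuous.
  apply: continuous_compose reverse_arg_continuous.
  exact: fst_continuous.
- by move=> s; rewrite H0.
- by move=> s; rewrite H1.
- by move=> t; rewrite ival0 subr0 clamp_ge1.
- by move=> t; rewrite ival1 subrr clamp_le0.
Qed.

Lemma homotopic_reparam x y (f : I -> X) (phi psi : I -> I)
    (a b : {path I from x to y in X}) :
  continuous f -> continuous phi -> continuous psi ->
  phi zero = psi zero -> phi one = psi one ->
  (forall t, a t = f (phi t)) -> (forall t, b t = f (psi t)) -> homotopic a b.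
Proof.
move=> cf cphi cpsi e0 e1 fa fb.
exists (fun st => f (clamp ((1 - ival st.2) * ival (phi st.1) +
                            ival st.2 * ival (psi st.1)))); split => /=.
- apply: continuous_compose cf; apply: continuous_clamp.
  have c2 : continuous (fun st : I * I => ival st.2).
    by apply: continuous_ival; exact: snd_continuous.
  have c1 (g : I -> I) : continuous g -> continuous (fun st : I * I => ival (g st.1)).
    by move=> cg; apply/continuous_ival/(continuous_compose _ cg)/fst_continuous.
  move=> st; apply: (@cvgD _ R^o).
    apply: (@cvgM R); last exact: c1.
    by apply: (@cvgB _ R^o); [exact: cvg_cst|exact: c2].
  by apply: (@cvgM R); [exact: c2|exact: c1].
- by move=> s; rewrite ival0 subr0 mul1r mul0r addr0 ivalK fa.
- by move=> s; rewrite ival1 subrr mul1r mul0r add0r ivalK fb.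
- by move=> t; rewrite e0 -mulrDl subrK mul1r ivalK -fb path_zero.
- by move=> t; rewrite e1 -mulrDl subrK mul1r ivalK -fb path_one.
Qed.

Lemma homotopic_concat1p x y (p : {path I from x to y in X}) :
  homotopic (path_concat (path_cst x) p) p.
Proof.
apply: (@homotopic_reparam _ _ p (fun t => clamp (2 * ival t - 1)) id).
- exact: cts_fun.
- exact: (@continuous_dil R I 2 (-1) id (@continuous_id_fun I)).
- exact: continuous_id_fun.
- by rewrite ival0 clamp_le0// mulr0 sub0r lerN10.
- by rewrite ival1 clamp_ge1// mulr1 lerBrDr.
- move=> t; rewrite /= /mk_path /concat_fun; case: ifPn => // t2.
  by rewrite (@clamp_le0 _ (2 * _ - 1)) ?path_zero//; lra.
- by [].
Qed.

Lemma homotopic_concatp1 x y (p : {path I from x to y in X}) :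
  homotopic (path_concat p (path_cst y)) p.
Proof.
apply: (@homotopic_reparam _ _ p (fun t => clamp (2 * ival t)) id).
- exact: cts_fun.
- exact: (@continuous_dil0 R I 2 id (@continuous_id_fun I)).
- exact: continuous_id_fun.
- by rewrite ival0 clamp_le0// mulr0.
- by rewrite ival1 clamp_ge1// mulr1 ler1n.
- move=> t; rewrite /= /mk_path /concat_fun; case: ifPn => // t2.
  by rewrite (@clamp_ge1 _ (2 * ival t)) ?path_one//; lra.
- by [].
Qed.

Lemma homotopic_concatpV x y (p : {path I from x to y in X}) :
  homotopic (path_concat p (path_reverse p)) (path_cst x).
Proof.
apply: (@homotopic_reparam _ _ p
  (fun t => clamp (Num.min (2 * ival t) (2 - 2 * ival t))) (fun=> zero)).
- exact: cts_fun.
- apply/continuous_clamp/continuous_minr.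
    under eq_fun do rewrite -[_ * _]addr0.
    by apply: continuous_affine; exact: ival_continuous.
  under eq_fun do rewrite addrC -mulNr.
  by apply: continuous_affine; exact: ival_continuous.
- exact: cst_continuous.
- by rewrite ival0 clamp_le0// ge_min mulr0 lexx.
- by rewrite ival1 clamp_le0// ge_min mulr1 subrr lexx orbT.
- move=> t; rewrite /= /mk_path /concat_fun /reverse_fun.
  have t0 := ival_ge0 t; have t1 := ival_le1 t.
  case: ifPn => [t2|/negbTE t2].
    by congr (p (clamp _)); case: leP => //; lra.
  rewrite clampK; [|lra|lra].
  by congr (p (clamp _)); case: leP => //; lra.
- by move=> t; rewrite path_zero.
Qed.

Lemma path_reverseK x y (p : {path I from x to y in X}) :
  path_reverse (path_reverse p) = p.
Proof.
apply/path_eqP => t /=; rewrite /mk_path /reverse_fun /= /mk_path /reverse_fun.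
have t0 := ival_ge0 t; have t1 := ival_le1 t.
by rewrite clampK ?subKr ?ivalK//; lra.
Qed.

Lemma homotopic_concatVp x y (p : {path I from x to y in X}) :
  homotopic (path_concat (path_reverse p) p) (path_cst y).
Proof. by rewrite -{2}[p]path_reverseK; exact: homotopic_concatpV. Qed.

Lemma homotopic_concatA x y z w (p : {path I from x to y in X})
    (q : {path I from y to z in X}) (r : {path I from z to w in X}) :
  homotopic (path_concat (path_concat p q) r) (path_concat p (path_concat q r)).
Proof.
apply: (@homotopic_reparam _ _ (path_concat p (path_concat q r)) (fun t => clamp
  (Num.min (2 * ival t) (Num.min (1 * ival t + 4^-1) (2^-1 * ival t + 2^-1)))) id).
- exact: cts_fun.
- apply/continuous_clamp/continuous_minr.
    under eq_fun do rewrite -[_ * _]addr0.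
    by apply: continuous_affine; exact: ival_continuous.
  by apply/continuous_minr; apply: continuous_affine; exact: ival_continuous.
- exact: continuous_id_fun.
- by rewrite ival0 clamp_le0// ge_min mulr0 lexx.
- by rewrite ival1 clamp_ge1// !le_min; apply/and3P; split; lra.
- move=> t; rewrite /= /mk_path /concat_fun /= /mk_path /concat_fun.
  have t0 := ival_ge0 t; have t1 := ival_le1 t.
  set m := Num.min _ _.
  have mE : m = if ival t <= 4^-1 then 2 * ival t else
                if ival t <= 2^-1 then ival t + 4^-1 else 2^-1 * ival t + 2^-1.
    rewrite /m; case: (leP (ival t) 4^-1) => t4.
      by apply/min_idPl; rewrite le_min; apply/andP; split; lra.
    case: (leP (ival t) 2^-1) => t2.
      rewrite (_ : Num.min (1 * _ + _) _ = ival t + 4^-1).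
        by apply/min_idPr; lra.
      by rewrite -[ival t in RHS]mul1r; apply/min_idPl; lra.
    rewrite (_ : Num.min (1 * _ + _) _ = 2^-1 * ival t + 2^-1).
      by apply/min_idPr; lra.
    by apply/min_idPr; lra.
  have m0 : 0 <= m by rewrite mE; do ![case: (leP (ival t)) => ?]; lra.
  have m1 : m <= 1 by rewrite mE; do ![case: (leP (ival t)) => ?]; lra.
  rewrite (clampK m0 m1) mE.
  have [t4|t4] := leP (ival t) 4^-1.
    have -> : ival t <= 2^-1 by lra.
    rewrite (@clampK _ (2 * ival t)); [|lra|lra].
    by have -> : 2 * ival t <= 2^-1 by lra.
  have [t2|t2] := leP (ival t) 2^-1.
    rewrite (@clampK _ (2 * ival t)); [|lra|lra].
    have -> : (2 * ival t <= 2^-1) = false by apply/lt_geF; lra.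
    have -> : (ival t + 4^-1 <= 2^-1) = false by apply/lt_geF; lra.
    rewrite (@clampK _ (2 * (_ + _) - 1)); [|lra|lra].
    have -> : 2 * (ival t + 4^-1) - 1 <= 2^-1 by lra.
    by congr (q (clamp _)); lra.
  have -> : (2^-1 * ival t + 2^-1 <= 2^-1) = false by apply/lt_geF; lra.
  rewrite (@clampK _ (2 * (_ + _) - 1)); [|lra|lra].
  have -> : (2 * (2^-1 * ival t + 2^-1) - 1 <= 2^-1) = false by apply/lt_geF; lra.
  by congr (r (clamp _)); lra.
- by [].
Qed.

Section pi1.
Variable x : X.

Definition homotopicb (p q : {path I from x to x in X}) : bool :=
  `[< homotopic p q >].

Lemma homotopicb_refl : reflexive homotopicb.
Proof. by move=> p; apply/asboolP/homotopic_refl. Qed.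

Lemma homotopicb_sym : symmetric homotopicb.
Proof. by move=> p q; apply/asboolP/asboolP; exact: homotopic_sym. Qed.

Lemma homotopicb_trans : transitive homotopicb.
Proof. by move=> q p r /asboolP pq /asboolP qr; apply/asboolP/(homotopic_trans pq). Qed.

Definition homotopic_equiv :=
  EquivRel homotopicb homotopicb_refl homotopicb_sym homotopicb_trans.

(* [pi1] carries the quotient of the compact-open topology on loops (see
   [pi1_openE]) and, further down, the group structure. *)
Definition pi1 : Type := {eq_quot homotopic_equiv}.

HB.instance Definition _ :=
  Topological.copy pi1 (quotient_topology {eq_quot homotopic_equiv}).
HB.instance Definition _ := Quotient.on pi1.

Definition path_class (p : {path I from x to x in X}) : pi1 := \pi_pi1 p.

Lemma path_classP p q : path_class p = path_class q <-> homotopic p q.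
Proof. by split => [/eqmodP/asboolP|pq]; last exact/eqmodP/asboolP. Qed.

Lemma path_class_repr (g : pi1) : path_class (repr g) = g.
Proof. exact: reprK. Qed.

Definition pi1_one : pi1 := path_class (path_cst x).
Definition pi1_inv (g : pi1) : pi1 := path_class (path_reverse (repr g)).
Definition pi1_mul (g h : pi1) : pi1 :=
  path_class (path_concat (repr g) (repr h)).

Lemma pi1_invE p : pi1_inv (path_class p) = path_class (path_reverse p).
Proof. by apply/path_classP/homotopic_reverse/path_classP/path_class_repr. Qed.

Lemma pi1_mulE p q :
  pi1_mul (path_class p) (path_class q) = path_class (path_concat p q).
Proof. by apply/path_classP/homotopic_concat; apply/path_classP/path_class_repr. Qed.

Lemma pi1_mulA : associative pi1_mul.
Proof.
move=> g h k; rewrite -[g]path_class_repr -[h]path_class_repr -[k]path_class_repr.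
by rewrite !pi1_mulE; apply/path_classP/homotopic_sym/homotopic_concatA.
Qed.

Lemma pi1_mul1g : left_id pi1_one pi1_mul.
Proof.
move=> g; rewrite -[g]path_class_repr pi1_mulE.
exact/path_classP/homotopic_concat1p.
Qed.

Lemma pi1_mulg1 : right_id pi1_one pi1_mul.
Proof.
move=> g; rewrite -[g]path_class_repr pi1_mulE.
exact/path_classP/homotopic_concatp1.
Qed.

Lemma pi1_mulVg : left_inverse pi1_one pi1_inv pi1_mul.
Proof.
move=> g; rewrite -[g]path_class_repr pi1_invE pi1_mulE.
exact/path_classP/homotopic_concatVp.
Qed.

Lemma pi1_mulgV : right_inverse pi1_one pi1_inv pi1_mul.
Proof.
move=> g; rewrite -[g]path_class_repr pi1_invE pi1_mulE.
exact/path_classP/homotopic_concatpV.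
Qed.

HB.instance Definition _ := isGroup.Build pi1
  pi1_mulA pi1_mul1g pi1_mulg1 pi1_mulVg pi1_mulgV.

Lemma path_class1 : path_class (path_cst x) = 1%g.
Proof. by []. Qed.

Lemma path_classM p q :
  (path_class p * path_class q)%g = path_class (path_concat p q).
Proof. exact: pi1_mulE. Qed.

Lemma path_classV p : ((path_class p)^-1)%g = path_class (path_reverse p).
Proof. exact: pi1_invE. Qed.

Lemma pi1_openE (U : set pi1) : open U <-> open (path_class @^-1` U).
Proof. by []. Qed.

End pi1.
End paths.
Arguments pi1 R {X} x.
Arguments path_cst R {X} x.

Section pi1_map.
Context {R : realType} {X Y : topologicalType} (f : continuousType X Y).
Local Notation I := (unit_interval R).
Implicit Types x y : X.

Lemma homotopic_map x y (p q : {path I from x to y in X}) :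
  homotopic p q -> homotopic (f \o p : {path I from f x to f y in Y})
                             (f \o q : {path I from f x to f y in Y}).
Proof.
move=> [H [cH H0 H1 Hx Hy]]; exists (f \o H); split => /=.
- by apply: (continuous_compose cH); exact: cts_fun.
- by move=> s; rewrite H0.
- by move=> s; rewrite H1.
- by move=> t; rewrite Hx.
- by move=> t; rewrite Hy.
Qed.

Definition pi1_map x (g : pi1 R x) : pi1 R (f x) :=
  path_class (f \o repr g : {path I from f x to f x in Y}).

Lemma pi1_mapE x (p : {path I from x to x in X}) :
  pi1_map (path_class p) =
  path_class (f \o p : {path I from f x to f x in Y}).
Proof. by apply/path_classP/homotopic_map/path_classP/path_class_repr. Qed.

Lemma pi1_map_mul x : {morph @pi1_map x : g h / (g * h)%g}.
Proof.
move=> g h; rewrite -[g]path_class_repr -[h]path_class_repr.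
rewrite path_classM !pi1_mapE path_classM; congr path_class.
by apply/path_eqP => t; rewrite /= /mk_path /concat_fun /=; case: ifPn.
Qed.

End pi1_map.
Arguments pi1_map {R X Y} f x g.

Section groups.
Context {G : groupType}.
Implicit Types (S H : set G) (g : G).

Definition subgroup_generated S : set G :=
  \bigcap_(H in [set H : set G | group_closed (mem H) /\ S `<=` H]) H.

Definition left_coset g H : set G := [set (g * h)%g | h in H].

(* Only used for the normal subgroup [small_generated_group], for which left
   and right cosets coincide. *)
Definition union_of_cosets H (U : set G) : Prop :=
  exists A : set G, U = \bigcup_(g in A) left_coset g H.

End groups.

Section small_generated.
Context (R : realType) {X : topologicalType}.
Local Notation I := (unit_interval R).
Implicit Types x y : X.

Definition small_loop_group y : set (pi1 R y) :=
  [set path_class b | b in [set b : {path I from y to y in X} |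
    forall V : set X, open V -> V y ->
      exists2 c : {path I from y to y in X}, homotopic b c & range c `<=` V]].

Definition small_generated_group x : set (pi1 R x) :=
  subgroup_generated [set g | exists (y : X) (a : {path I from x to y in X})
      (b : {path I from y to y in X}), small_loop_group (path_class b) /\
      g = path_class (path_concat (path_concat a b) (path_reverse a))].

Definition inclusion (U : set X) : set_type U -> X := set_val.

Lemma inclusion_continuous (U : set X) : continuous (@inclusion U).
Proof. exact: initial_continuous. Qed.

HB.instance Definition _ (U : set X) :=
  isContinuous.Build _ _ (@inclusion U) (@inclusion_continuous U).

(* [inclusion (SigSub xU)] is convertible to [x], so both sides of the
   inclusion below are sets of elements of [pi1 R x]. *)
Definition semilocally_small_generated : Prop :=
  forall x, exists (U : set X) (xU : x \in U), open U /\
    range (pi1_map (@inclusion U) (SigSub xU)) `<=` @small_generated_group x.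

Definition path_connected (A : set X) : Prop :=
  forall x y, A x -> A y ->
    exists p : {path I from x to y in X}, range p `<=` A.

Definition locally_path_connected : Prop :=
  forall x (U : set X), open_nbhs x U ->
    exists V : set X, [/\ open_nbhs x V, V `<=` U & path_connected V].

End small_generated.
Arguments small_generated_group R {X} x.
Arguments semilocally_small_generated R X : clear implicits.
Arguments locally_path_connected R X : clear implicits.

(* Main.v *)
Require Import Defs.
From mathcomp Require Import all_boot all_order all_algebra.
From mathcomp Require Import all_classical reals topology normedtype homotopy.
(* Not imported: the notation [-->] of Morphisms clashes with that of limits. *)
From Corelib Require RelationClasses Morphisms.
From mathcomp Require Import lra.

(* An open set of pi_1^qtop is always a union of cosets of the SG subgroup: if
   [p] is in its preimage, then so are all loops near p a 1 a^-1, among which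
   p a c a^-1 for [c] in a small neighborhood of the end of [a], and a small
   loop [b] is homotopic to such a [c].

   Hence (ii) says that the SG subgroup is open. If so, its preimage contains
   all loops in some neighborhood of the base point, which is (i). Conversely,
   under (i) a loop [q] close to [p] can be joined to [p] by a ladder of short
   paths whose cells are loops in small path connected sets; these belong to the
   SG subgroup, so that [p] and [q] are in the same coset. *)

Import Order.TTheory GRing.Theory Num.Theory numFieldNormedType.Exports.
Set Implicit Arguments.
Unset Strict Implicit.
Unset Printing Implicit Defensive.

Local Open Scope classical_set_scope.
Local Open Scope ring_scope.

#[local] Hint Resolve homotopic_refl : core.

(** * Subgroups generated by a set *)

Section subgroup_generated.
Context {G : groupType}.
Implicit Types S H : set G.

Lemma sub_subgroup_generated S : S `<=` subgroup_generated S.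
Proof. by move=> g Sg H [_]; apply. Qed.

Lemma subgroup_generated_min S H : group_closed (mem H) -> S `<=` H ->
  subgroup_generated S `<=` H.
Proof. by move=> gH SH g; apply. Qed.

Lemma subgroup_generated_closed S : group_closed (mem (subgroup_generated S)).
Proof.
split; first by rewrite inE => H [[+ _] _]; rewrite inE.
move=> g h /set_mem Sg /set_mem Sh; rewrite inE => H [gH SH].
by apply/set_mem/gH.2; rewrite inE; [apply: Sg|apply: Sh].
Qed.

End subgroup_generated.

(** * Groupoid laws of paths up to homotopy, for setoid rewriting *)

Section homotopic_setoid.
Context {R : realType} {X : topologicalType}.
Local Notation I := (unit_interval R).

#[export] Instance homotopic_Equivalence (x y : X) :
  RelationClasses.Equivalence (@homotopic R X x y).
Proof.
split; [exact: homotopic_refl|exact: homotopic_sym|].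
by move=> p q r; exact: homotopic_trans.
Qed.

#[export] Instance path_concat_Proper (x y z : X) :
  Morphisms.Proper (Morphisms.respectful (@homotopic R X x y)
    (Morphisms.respectful (@homotopic R X y z) (@homotopic R X x z)))
    (@path_concat R X x y z).
Proof. by move=> p p' pp' q q' qq'; exact: homotopic_concat. Qed.

#[export] Instance path_reverse_Proper (x y : X) :
  Morphisms.Proper (Morphisms.respectful (@homotopic R X x y)
    (@homotopic R X y x)) (@path_reverse R X x y).
Proof. by move=> p p'; exact: homotopic_reverse. Qed.

Lemma homotopic_concatKV x y z (p : {path I from x to y in X})
    (q : {path I from x to z in X}) :
  homotopic (path_concat p (path_concat (path_reverse p) q)) q.
Proof.
by rewrite -homotopic_concatA homotopic_concatpV homotopic_concat1p.
Qed.

Lemma homotopic_concatVK x y z (p : {path I from y to x in X})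
    (q : {path I from x to z in X}) :
  homotopic (path_concat (path_reverse p) (path_concat p q)) q.
Proof.
by rewrite -homotopic_concatA homotopic_concatVp homotopic_concat1p.
Qed.

(** Uniqueness of inverses: the right-hand side inverts [path_concat p q], which is then cancelled
    on the left. *)
Lemma homotopic_reverse_concat x y z (p : {path I from x to y in X})
    (q : {path I from y to z in X}) :
  homotopic (path_reverse (path_concat p q))
            (path_concat (path_reverse q) (path_reverse p)).
Proof.
have e : homotopic (path_cst R x)
    (path_concat (path_concat p q)
      (path_concat (path_reverse q) (path_reverse p))).
  by rewrite homotopic_concatA homotopic_concatKV homotopic_concatpV.
rewrite -[X in homotopic X _](homotopic_concatp1) e.
by rewrite homotopic_concatVK.
Qed.

End homotopic_setoid.

(** * Change of base point, and paths modulo the SG subgroup *)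

Section small_generated_equivalence.
Context {R : realType} {X : topologicalType}.
Local Notation I := (unit_interval R).
Implicit Types x y z : X.

Lemma small_generated_closed x :
  group_closed (mem (small_generated_group R x)).
Proof. exact: subgroup_generated_closed. Qed.

Section transport.
Variables (x y : X) (d : {path I from y to x in X}).

Definition pi1_transport (g : pi1 R x) : pi1 R y :=
  path_class (path_concat (path_concat d (repr g)) (path_reverse d)).

Lemma pi1_transportE (p : {path I from x to x in X}) :
  pi1_transport (path_class p) =
  path_class (path_concat (path_concat d p) (path_reverse d)).
Proof.
by apply/path_classP; rewrite (iffLR (path_classP _ _) (path_class_repr _)).
Qed.

Lemma pi1_transport1 : pi1_transport 1%g = 1%g.
Proof.
rewrite -[1%g]path_class1 pi1_transportE; apply/path_classP.
by rewrite homotopic_concatp1 homotopic_concatpV.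
Qed.

(** The form with a quotient is the one that [group_closed] asks for. *)
Lemma pi1_transport_div (g h : pi1 R x) :
  pi1_transport (g / h)%g = (pi1_transport g / pi1_transport h)%g.
Proof.
rewrite -[g]path_class_repr -[h]path_class_repr.
rewrite [((path_class (repr h))^-1)%g]path_classV path_classM.
rewrite !pi1_transportE !path_classV path_classM; apply/path_classP.
rewrite !homotopic_reverse_concat path_reverseK !homotopic_concatA.
by rewrite homotopic_concatVK.
Qed.

(** Transport is a morphism, so the preimage of the SG subgroup is a subgroup; the generator given
    by [a] and [b] goes to the one given by [path_concat d a] and [b]. *)
Lemma small_generated_transport (g : pi1 R x) :
  small_generated_group R x g ->
  small_generated_group R y (pi1_transport g).
Proof.
have [sg1 sgB] := small_generated_closed y.
move: g; apply: (@subgroup_generated_min _ _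
  (pi1_transport @^-1` small_generated_group R y)).
  split; first by rewrite inE /= pi1_transport1; exact: set_mem sg1.
  move=> h k; rewrite !inE /= => sh sk.
  by rewrite pi1_transport_div; apply/set_mem/sgB; rewrite inE.
move=> _ [z [a [b [sb ->]]]] /=; apply: sub_subgroup_generated.
exists z, (path_concat d a), b; split=> //; rewrite pi1_transportE.
apply/path_classP.
by rewrite homotopic_reverse_concat !homotopic_concatA.
Qed.

End transport.

(** For loops this is equality of left cosets of the SG subgroup; distinct end points are allowed so
    that pieces of a ladder can be compared. *)
Definition sg_equiv x y (p q : {path I from x to y in X}) : Prop :=
  small_generated_group R y (path_class (path_concat (path_reverse p) q)).

Lemma small_generated1 x : small_generated_group R x 1%g.
Proof. by have [/set_mem] := small_generated_closed x. Qed.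

Lemma small_generatedV x g :
  small_generated_group R x g -> small_generated_group R x g^-1%g.
Proof.
by rewrite -!(in_setE (small_generated_group R x));
  apply/group_closedV/small_generated_closed.
Qed.

Lemma small_generatedM x g h : small_generated_group R x g ->
  small_generated_group R x h -> small_generated_group R x (g * h)%g.
Proof.
by rewrite -!(in_setE (small_generated_group R x));
  apply/group_closedM/small_generated_closed.
Qed.

Lemma homotopic_sg_equiv x y (p q : {path I from x to y in X}) :
  homotopic p q -> sg_equiv p q.
Proof.
move=> pq; rewrite /sg_equiv.
have -> : path_class (path_concat (path_reverse p) q) = 1%g.
  by apply/path_classP; rewrite pq homotopic_concatVp.
exact: small_generated1.
Qed.

#[export] Instance homotopic_sg_equiv_subrelation x y :
  RelationClasses.subrelation (@homotopic R X x y) (@sg_equiv x y).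
Proof. by move=> p q; exact: homotopic_sg_equiv. Qed.

#[export] Instance sg_equiv_Equivalence x y :
  RelationClasses.Equivalence (@sg_equiv x y).
Proof.
split.
- by move=> p; exact: homotopic_sg_equiv.
- move=> p q /small_generatedV; rewrite path_classV; congr (_ _).
  by apply/path_classP; rewrite homotopic_reverse_concat path_reverseK.
- move=> p q r pq /(small_generatedM pq); rewrite path_classM; congr (_ _).
  by apply/path_classP; rewrite homotopic_concatA homotopic_concatKV.
Qed.

(** Normality in groupoid form: (p q)^-1 (p' q') is q^-1 (p^-1 p') q times q^-1 q', and the first
    factor is the transport of an SG element. *)
#[export] Instance path_concat_sg_Proper x y z :
  Morphisms.Proper (Morphisms.respectful (@sg_equiv x y)
    (Morphisms.respectful (@sg_equiv y z) (@sg_equiv x z)))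
    (@path_concat R X x y z).
Proof.
move=> p p' pp' q q' qq'.
have := small_generatedM (small_generated_transport (path_reverse q) pp') qq'.
rewrite pi1_transportE path_classM; congr (_ _); apply/path_classP.
rewrite path_reverseK homotopic_reverse_concat !homotopic_concatA.
by rewrite homotopic_concatKV.
Qed.

Lemma sg_equiv_loop x (l : {path I from x to x in X}) :
  small_generated_group R x (path_class l) -> sg_equiv l (path_cst R x).
Proof.
move/small_generatedV; rewrite path_classV; congr (_ _).
by apply/path_classP; rewrite homotopic_concatp1.
Qed.

End small_generated_equivalence.

(** * Connectedness, compactness and segments of the unit interval *)

Section unit_interval_topology.
Context {R : realType}.
Local Notation I := (unit_interval R).

Lemma range_clamp : range (@clamp R) = [set: I].
Proof. by apply/seteqP; split=> // t _; exists (ival t); rewrite ?ivalK. Qed.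

Lemma unit_interval_connected : connected [set: I].
Proof.
rewrite -range_clamp; apply: connected_continuous_connected.
  by apply/connected_intervalP => ? ? _ _ ? _.
exact/continuous_subspaceT/clamp_continuous.
Qed.

Lemma unit_interval_compact : compact [set: I].
Proof.
have -> : [set: I] = @clamp R @` `[0, 1].
  apply/seteqP; split=> // t _; exists (ival t); rewrite ?ivalK//=.
  by rewrite in_itv /= ival_ge0 ival_le1.
apply: continuous_compact; last exact: segment_compact.
exact/continuous_subspaceT/clamp_continuous.
Qed.

(** Two times close to [t] can play [s] and [u] in either order, so [P] is locally constant; both
    [P] and its complement are open, and connectedness concludes. *)
Lemma unit_interval_ind (P : set I) : P zero ->
  (forall t : I, \forall s \near t & u \near t, P s -> P u) -> forall t, P t.
Proof.
move=> P0 step.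
have stepJ (t : I) : exists2 J, nbhs t J & forall s u, J s -> J u -> P s -> P u.
  have [[A B] [/= At Bt] AB] := step t.
  exists (A `&` B); first exact: filterI.
  by move=> s u [As _] [_ Bu]; exact: (AB (s, u)).
suff -> : P = setT by [].
apply: unit_interval_connected; first by exists zero.
- exists P; last by rewrite setTI.
  rewrite openE => t Pt; have [J Jt JP] := stepJ t.
  apply: filterS (Jt) => u Ju; exact: JP (nbhs_singleton Jt) Ju Pt.
- exists P; last by rewrite setTI.
  rewrite -openC openE => t Pt; have [J Jt JP] := stepJ t.
  apply: filterS (Jt) => u Ju Pu; apply: Pt.
  exact: JP Ju (nbhs_singleton Jt) Pu.
Qed.

(** [clamp] only supplies the type, since a convex combination stays in [0, 1]; see
    [ival_segment]. *)
Definition segment_fun (s u t : I) : I :=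
  clamp ((1 - ival t) * ival s + ival t * ival u).

Lemma segment_cts s u : continuous (segment_fun s u).
Proof.
rewrite (_ : segment_fun s u =
  fun t => clamp ((ival u - ival s) * ival t + ival s)).
  exact: (@continuous_dil R I _ _ id (@continuous_id_fun I)).
by apply/funext => t; congr clamp; lra.
Qed.

Lemma segment_zero s u : segment_fun s u zero = s.
Proof. by rewrite /segment_fun ival0 subr0 mul1r mul0r addr0 ivalK. Qed.

Lemma segment_one s u : segment_fun s u one = u.
Proof. by rewrite /segment_fun ival1 subrr mul0r mul1r add0r ivalK. Qed.

Definition path_segment s u : {path I from s to u in I} :=
  mk_path (@segment_cts s u) (segment_zero s u) (segment_one s u).

Lemma ival_segment s u t :
  ival (segment_fun s u t) = (1 - ival t) * ival s + ival t * ival u.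
Proof.
have := ival_ge0 t; have := ival_le1 t.
have := ival_ge0 s; have := ival_le1 s; have := ival_ge0 u; have := ival_le1 u.
rewrite /segment_fun; move: (ival s) (ival u) (ival t) => a b c *.
by rewrite clampK //; nra.
Qed.

(** Balls of the real line are convex. *)
Lemma near_path_segment (t : I) (O : set I) : nbhs t O ->
  \forall s \near t & u \near t, range (path_segment s u) `<=` O.
Proof.
move=> -[_ [[A oA <-] /= At] AO].
have /nbhs_ballP[e /= e0 eA] : nbhs (ival t) A by exact: open_nbhs_nbhs.
have bt : nbhs t (ival @^-1` ball (ival t) e).
  by apply: ival_continuous; exact: nbhsx_ballx.
exists (ival @^-1` ball (ival t) e, ival @^-1` ball (ival t) e) => //.
move=> [s u] [/= bs bu] _ [v _ <-]; apply/AO/eA; move: bs bu.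
rewrite /ball /= -/(ival _) ival_segment !ltr_norml.
move=> /andP[s1 s2] /andP[u1 u2].
have := ival_ge0 v; have := ival_le1 v.
move: (ival s) (ival u) (ival v) (ival t) s1 s2 u1 u2 => a b c d *.
have [ab|ba] := leP a b.
  have : a <= (1 - c) * a + c * b by nra.
  have : (1 - c) * a + c * b <= b by nra.
  by move: (_ + _) => w *; apply/andP; split; lra.
have : (1 - c) * a + c * b <= a by nra.
have : b <= (1 - c) * a + c * b by nra.
by move: (_ + _) => w *; apply/andP; split; lra.
Qed.

End unit_interval_topology.

(** * The compact-open topology on paths *)

Section path_topology.
Context {R : realType} {X : topologicalType}.
Local Notation I := (unit_interval R).
Implicit Types x y z : X.

Lemma open_path_image x y (K : set I) (O : set X) : compact K -> open O ->
  open [set p : {path I from x to y in X} | p @` K `<=` O].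
Proof.
move=> cK oO.
by exists [set f : {compact-open, I -> X} | f @` K `<=` O];
  first exact: compact_open_open.
Qed.

(* A basic neighborhood only constrains the values of [g]; at the times where
   [f] sits at [z], all constraints are satisfied by points close to [z]. *)
Lemma nbhs_path_replace x y z (f : {path I from x to y in X}) N : nbhs f N ->
  exists V : set X, [/\ open V, V z & forall g : {path I from x to y in X},
    (forall t, g t = f t \/ f t = z /\ V (g t)) -> N g].
Proof.
move=> [_ [[C oC <-] /= Cf] CN].
(* The filter of the allowed replacements of [f] as [V] shrinks to [z]; its convergence to [f] is
   the claim. *)
pose F : set_system {compact-open, I -> X} := filter_from (open_nbhs z)
  (fun V => [set g : I -> X | forall t, g t = f t \/ f t = z /\ V (g t)]).
have FF : Filter F.
  apply: filter_from_filter; first by exists setT; split=> //; exact: openT.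
  move=> V W [oV Vz] [oW Wz]; exists (V `&` W).
    by split=> //; exact: openI.
  by move=> g gVW; split=> t; have [|[? []]] := gVW t; [left|right|left|right].
have cF : F --> (f : {compact-open, I -> X}).
  apply/compact_open_cvgP => K O cK oO fKO.
  (* If [f] sits at [z] at some time of [K], then [z] is in [O], which serves as [V]; otherwise [g]
     agrees with [f] on [K]. *)
  have [[t Kt ft]|nK] := pselect (exists2 t, K t & f t = z).
    exists O; first by split=> //; rewrite -ft; apply: fKO; exists t.
    move=> g gO _ [s Ks <-]; have [->|[]//] := gO s.
    by apply: fKO; exists s.
  exists setT; first by split=> //; exact: openT.
  move=> g gO _ [s Ks <-]; have [->|[fs]] := gO s.
    by apply: fKO; exists s.
  by exfalso; apply: nK; exists s.
have [V [oV Vz] VC] : F C by apply: cF; exact: open_nbhs_nbhs.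
by exists V; split=> // g gV; apply/CN/VC.
Qed.

Lemma range_path_concat x y z (p : {path I from x to y in X})
    (q : {path I from y to z in X}) (U : set X) :
  range p `<=` U -> range q `<=` U -> range (path_concat p q) `<=` U.
Proof.
move=> pU qU _ [t _ <-]; rewrite /= /mk_path /concat_fun.
by case: ifPn => _; [apply: pU|apply: qU]; eexists.
Qed.

Lemma range_path_reverse x y (p : {path I from x to y in X}) (U : set X) :
  range p `<=` U -> range (path_reverse p) `<=` U.
Proof. by move=> pU _ [t _ <-]; apply: pU; eexists. Qed.

End path_topology.

(** * Open sets as unions of cosets, and (i) from an open SG subgroup *)

Section open_cosets.
Context {R : realType} {X : topologicalType}.
Local Notation I := (unit_interval R).
Implicit Types x y z : X.

Lemma small_loop_groupV y (b : {path I from y to y in X}) :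
  small_loop_group (path_class b) ->
  small_loop_group (path_class (path_reverse b)).
Proof.
move=> [b' sb' /path_classP bb']; exists (path_reverse b'); last first.
  by apply/path_classP; rewrite bb'.
move=> V oV Vy; have [c b'c cV] := sb' V oV Vy.
by exists (path_reverse c); [rewrite b'c|exact: range_path_reverse].
Qed.

Lemma open_small_generator x y (U : set (pi1 R x)) (g : pi1 R x)
    (a : {path I from x to y in X}) (b : {path I from y to y in X}) :
  open U -> U g -> small_loop_group (path_class b) ->
  U (g * path_class (path_concat (path_concat a b) (path_reverse a)))%g.
Proof.
move=> /pi1_openE oU Ug [b' sb' /path_classP b'b].
(* [c] fills the times from 1/4 to 1/2, when [loop (path_cst R y)] rests at [y]; elsewhere [loop c]
   does not depend on [c]. *)
pose loop (c : {path I from y to y in X}) :=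
  path_concat (path_concat (path_concat (repr g) a) c) (path_reverse a).
have loopE c : path_class (loop c) =
    (g * path_class (path_concat (path_concat a c) (path_reverse a)))%g.
  rewrite -[g in RHS]path_class_repr path_classM; apply/path_classP.
  by rewrite /loop !homotopic_concatA.
have : nbhs (loop (path_cst R y)) (@path_class R X x @^-1` U).
  apply: open_nbhs_nbhs; split=> //=; rewrite loopE.
  rewrite (_ : path_class _ = 1%g) ?mulg1//; apply/path_classP.
  by rewrite homotopic_concatp1 homotopic_concatpV.
move=> /(nbhs_path_replace y)[V [oV Vy VU]].
have [c b'c cV] := sb' V oV Vy.
have <- : path_class (loop c) =
    (g * path_class (path_concat (path_concat a b) (path_reverse a)))%g.
  by rewrite loopE; congr (_ * _)%g; apply/path_classP; rewrite -b'c b'b.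
apply: VU => t; rewrite /loop /= /mk_path /concat_fun /=.
rewrite /mk_path /concat_fun /=.
case: ifPn => _; last by left.
by case: ifPn => _; [left|right; split=> //; apply: cV; eexists].
Qed.

Lemma open_union_of_cosets x (U : set (pi1 R x)) :
  open U -> union_of_cosets (small_generated_group R x) U.
Proof.
move=> oU; exists U; apply/seteqP; split=> [g Ug|g [h Uh [k sk <-]]].
  by exists g => //; exists 1%g; [exact: small_generated1|rewrite mulg1].
(* The stabilizer of [U] under right multiplication is a subgroup, so only generators need
   checking. *)
pose H := [set k : pi1 R x | forall h, U h <-> U (h * k)%g].
have gH : group_closed (mem H).
  split; first by rewrite inE => h'; rewrite mulg1.
  move=> k1 k2; rewrite !inE => H1 H2 h'.
  by rewrite (H2 (h' * (k1 / k2))%g) -mulgA divgK.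
suff : H k by move=> /(_ h)[+ _]; exact.
apply: subgroup_generated_min gH _ _ sk => _ [y [a [b [sb ->]]]] h'.
split=> [Uh'|]; first exact: open_small_generator.
set s := path_class _ => Us.
(* The generator built from the reverse of [b] is the inverse of [s]. *)
have := open_small_generator a oU Us (small_loop_groupV sb).
rewrite (_ : path_class _ = s^-1%g) ?mulgK//.
rewrite path_classV; apply/path_classP.
by rewrite !homotopic_reverse_concat path_reverseK !homotopic_concatA.
Qed.

(** The constant loop sits at [x] at all times, so [nbhs_path_replace] puts every loop inside some
    [V] in the preimage of the SG subgroup. *)
Lemma open_small_generated_semilocal :
  (forall x, open (small_generated_group R x)) ->
  semilocally_small_generated R X.
Proof.
move=> oH x.
have : nbhs (path_cst R x) (@path_class R X x @^-1` small_generated_group R x).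
  by apply: open_nbhs_nbhs; split; [exact/pi1_openE/oH|exact: small_generated1].
move=> /(nbhs_path_replace x)[V [oV Vx VH]].
exists V, (mem_set Vx); split=> // _ [g _ <-].
apply: VH => t; right; split=> //.
exact: set_mem (valP (repr g t)).
Qed.

End open_cosets.

(** * Unions of cosets are open under (i) *)

Section semilocal.
Context {R : realType} {X : topologicalType}.
Local Notation I := (unit_interval R).
Implicit Types x y z : X.

Lemma path_class_inclusion x (U : set X) (xU : x \in U)
    (l : {path I from x to x in X}) : range l `<=` U ->
  range (pi1_map (@inclusion X U) (SigSub xU)) (path_class l).
Proof.
move=> lU; have lU' t : l t \in U by rewrite inE; apply: lU; exists t.
pose f (t : I) : set_type U := SigSub (lU' t).
have cf : continuous f by apply: continuous_comp_initial; exact: cts_fun.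
have f0 : f zero = SigSub xU by apply: val_inj; exact: path_zero.
have f1 : f one = SigSub xU by apply: val_inj; exact: path_one.
exists (path_class (mk_path cf f0 f1)) => //.
rewrite pi1_mapE; congr path_class.
exact/path_eqP.
Qed.

(** Condition (i) concerns loops at [z] only; a loop at [w] is first conjugated by a path [d] inside
    [V], then transported back. *)
Lemma semilocal_small_generated_nbhs :
  locally_path_connected R X -> semilocally_small_generated R X ->
  forall z, exists V : set X, open_nbhs z V /\
    forall w (l : {path I from w to w in X}), V w -> range l `<=` V ->
      sg_equiv l (path_cst R w).
Proof.
move=> lpc slsg z; have [U [zU [oU UH]]] := slsg z.
have [V [[oV Vz] VU pV]] := lpc z U (conj oU (set_mem zU)).
exists V; split=> // w l Vw lV; have [d dV] := pV z w Vz Vw.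
apply: sg_equiv_loop.
have dld : range (path_concat (path_concat d l) (path_reverse d)) `<=` U.
  apply: subset_trans VU.
  by do ![apply: range_path_concat => //]; exact: range_path_reverse.
have /UH/(small_generated_transport (path_reverse d)) :=
  path_class_inclusion zU dld.
rewrite pi1_transportE; congr (_ _); apply/path_classP.
by rewrite path_reverseK !homotopic_concatA homotopic_concatVK
  homotopic_concatVp homotopic_concatp1.
Qed.

Section subpath.
Variables (x y : X) (p : {path I from x to y in X}).

Definition subpath (s u : I) : {path I from p s to p u in X} :=
  p \o path_segment s u.

Lemma initial_part_zero t : subpath zero t zero = x.
Proof. by rewrite path_zero path_zero. Qed.

(** Retyped to start at [x], which equals [p zero] only propositionally. *)
Definition initial_part (t : I) : {path I from x to p t in X} :=
  mk_path (@cts_fun _ _ (subpath zero t)) (initial_part_zero t)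
    (@path_one _ _ _ _ (subpath zero t)).

(** Both sides follow [p] along paths of times from zero to [u], and such reparametrizations are
    homotopic. *)
Lemma homotopic_initial_part s u :
  homotopic (initial_part u) (path_concat (initial_part s) (subpath s u)).
Proof.
apply: (@homotopic_reparam _ _ _ _ p (path_segment zero u)
  (path_concat (path_segment zero s) (path_segment s u))).
- exact: cts_fun.
- exact: cts_fun.
- exact: cts_fun.
- by rewrite !path_zero.
- by rewrite !path_one.
- by [].
- move=> t; rewrite /= /mk_path /concat_fun /=.
  by case: ifPn.
Qed.

Lemma initial_part_one : initial_part one =1 p.
Proof.
move=> t; rewrite /= /mk_path /=; congr (p _).
by rewrite /mk_path /segment_fun ival0 ival1 mulr0 mulr1 add0r ivalK.
Qed.

End subpath.

(** Meant for initial parts at time one, which end at [p one] and [q one]: with variable end points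
    [z] and [w], both can be replaced by [y], and the rung [c] becomes a negligible loop. *)
Lemma sg_equiv_endpoints x y z w (p q : {path I from x to y in X})
    (p' : {path I from x to z in X}) (q' : {path I from x to w in X})
    (c : {path I from z to w in X}) (V : set X) :
  p' =1 p -> q' =1 q ->
  (forall l : {path I from y to y in X},
    range l `<=` V -> sg_equiv l (path_cst R y)) ->
  range c `<=` V -> sg_equiv (path_concat p' c) q' -> sg_equiv p q.
Proof.
move=> p'p q'q small cV.
have ez : z = y by rewrite -(@path_one _ _ _ _ p') p'p path_one.
have ew : w = y by rewrite -(@path_one _ _ _ _ q') q'q path_one.
subst z w; move/path_eqP: p'p => ->; move/path_eqP: q'q => ->.
by rewrite (small c cV) homotopic_concatp1.
Qed.

(* Induction over the connected space of times [t] up to which [q] is compared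
   with [p]; [c] is the rung of the ladder at time [t]. *)
Lemma near_initial_part x y (p : {path I from x to y in X}) :
  locally_path_connected R X -> semilocally_small_generated R X ->
  forall (t : I) (V : set X), open_nbhs (p t) V ->
    nbhs p [set q : {path I from x to y in X} |
      exists2 c : {path I from p t to q t in X}, range c `<=` V &
        sg_equiv (path_concat (initial_part p t) c) (initial_part q t)].
Proof.
move=> lpc slsg; apply: unit_interval_ind => [V [oV Vp]|t].
  apply: filterE => q.
  have pq : p zero = q zero by rewrite !path_zero.
  (* Both paths start at [x], so the first rung is constant. *)
  exists (mk_path (@cst_continuous I X (p zero)) erefl pq).
    by move=> _ [t _ <-].
  apply: homotopic_sg_equiv.
  have E (r : {path I from x to y in X}) t : initial_part r zero t = x.
    rewrite /= /mk_path /= /mk_path /segment_fun !ival0 !mulr0 add0r.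
    by rewrite clamp_le0// path_zero.
  apply: (@homotopic_reparam _ _ _ _ (cst x) id id) => // [|||s].
  - exact: cst_continuous.
  - exact: continuous_id_fun.
  - exact: continuous_id_fun.
  - rewrite /= /mk_path /concat_fun E; case: ifPn => // _.
    by rewrite /= /mk_path path_zero.
have [W [[oW Wp] small]] := semilocal_small_generated_nbhs lpc slsg (p t).
have /near_path_segment : nbhs t (p @^-1` W).
  by apply: (@cts_fun _ _ p t); exact: open_nbhs_nbhs.
apply: filterS => -[s u] /= suW ind V [oV Vp].
have Wsu v : range (path_segment s u) v -> W (p v) by exact: suW.
have Ws : W (p s) by apply: Wsu; exists zero; rewrite ?path_zero.
have Wu : W (p u) by apply: Wsu; exists one; rewrite ?path_one.
(* The rung at [u] is taken in [V']: inside [V] as required, and inside [W] to keep the cell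
   there. *)
have [V' [[oV' V'p] V'V pV']] := lpc _ _ (conj (openI oV oW) (conj Vp Wu)).
have nearW : nbhs p [set q : {path I from x to y in X} |
    q @` range (path_segment s u) `<=` W].
  apply: open_nbhs_nbhs; split; last by move=> _ [v sv <-]; exact: Wsu.
  apply: open_path_image oW.
  apply: continuous_compact; last exact: unit_interval_compact.
  exact/continuous_subspaceT/cts_fun.
have nearV' : nbhs p [set q : {path I from x to y in X} |
    q @` [set u] `<=` V'].
  apply: open_nbhs_nbhs; split; last by move=> _ [v -> <-].
  by apply: open_path_image oV'; exact: compact_set1.
(* As the induction hypothesis holds for all neighborhoods, the rung at [s] can be asked to lie in
   [W]. *)
have := ind W (conj oW Ws).
apply: filter_app; apply: filter_app nearV'; apply: filterS nearW.
move=> q qW qV' [c cW pcq].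
have [d dV'] := pV' (p u) (q u) V'p (qV' _ (ex_intro2 _ _ u erefl erefl)).
exists d; first by move=> ? /dV' /V'V[].
have dW : range d `<=` W by move=> ? /dV' /V'V[].
(* The boundary of the cell between [s] and [u], a loop at [p s] inside [W]. *)
set l := path_concat (subpath p s u)
  (path_concat d (path_concat (path_reverse (subpath q s u)) (path_reverse c))).
have lW : range l `<=` W.
  have pW : range (subpath p s u) `<=` W.
    by move=> _ [v _ <-]; apply: Wsu; exists v.
  have qW' : range (subpath q s u) `<=` W.
    by move=> _ [v _ <-]; apply: qW; eexists; [exists v|].
  by do ![apply: range_path_concat => //]; exact: range_path_reverse.
(* Inserting [l] trades the rung at [u] for the rung at [s]; [l] is then dropped modulo the SG
   subgroup. *)
have e : homotopic (path_concat (initial_part p u) d)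
    (path_concat (initial_part p s)
      (path_concat l (path_concat c (subpath q s u)))).
  rewrite (homotopic_initial_part p s u) /l !homotopic_concatA.
  by rewrite homotopic_concatVK homotopic_concatVp homotopic_concatp1.
rewrite e (small _ _ Ws lW) homotopic_concat1p -homotopic_concatA pcq.
exact: homotopic_sg_equiv (homotopic_sym (homotopic_initial_part q s u)).
Qed.

Lemma union_of_cosets_open x (U : set (pi1 R x)) :
  locally_path_connected R X -> semilocally_small_generated R X ->
  union_of_cosets (small_generated_group R x) U -> open U.
Proof.
move=> lpc slsg [A ->]; apply/pi1_openE; rewrite openE => p [g Ag [h sh gh]].
have [V [[oV Vx] small]] := semilocal_small_generated_nbhs lpc slsg x.
have Vp1 : V (p one) by rewrite path_one.
(* At time one the rung is a loop in [V], so [p] and [q] agree modulo the SG subgroup. *)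
have := near_initial_part lpc slsg (conj oV Vp1).
apply: filterS => q [c cV pcq]; exists g => //.
have pq := sg_equiv_endpoints (initial_part_one p) (initial_part_one q)
  (small x ^~ Vx) cV pcq.
exists (h * path_class (path_concat (path_reverse p) q))%g.
  exact: small_generatedM.
rewrite mulgA gh path_classM; apply/path_classP.
exact: homotopic_concatKV.
Qed.

End semilocal.

Theorem theorem3p8 (R : realType) (X : topologicalType)
    (cX : connected [set: X]) (lpcX : locally_path_connected R X) :
  semilocally_small_generated R X <->
  (forall (x : X) (U : set (pi1 R x)), U !=set0 ->
     (open U <-> union_of_cosets (small_generated_group R x) U)).
Proof.
split=> [slsg x U _|H].
  by split; [exact: open_union_of_cosets|exact: union_of_cosets_open].
(* Statement (ii) is applied to the SG subgroup itself, the coset of 1. *)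
apply: open_small_generated_semilocal => x; apply/H.
  by exists 1%g; exact: small_generated1.
exists [set 1%g]; rewrite bigcup_set1; apply/seteqP; split=> [g sg|_ [g sg <-]].
  by exists g => //; rewrite mul1g.
by rewrite mul1g.
Qed.
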